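(* For infinitely many values of $k$, there is a graph $G'=(V(G'),E(G'))$ and a set $K\subseteq V(G')$ of size $k$ for which any flow-sparsifier that is a convex combination of $0$-extension graphs has quality at least $\Omega(\sqrt{\log k})$.
   Context: Graphs are undirected and carry edge capacities $c:E\to\mathbb{R}_{\ge0}$; the vertices in the given set $K$ are called terminals. A $K$-flow is a multicommodity flow all of whose sources and sinks lie in $K$. It is feasible if the total flow on each edge is at most its capacity, and has congestion $\rho$ if the total flow on each edge is at most $\rho$ times its capacity. A flow-sparsifier for a capacitated graph $(G,c)$ and terminals $K$ with quality $\rho\ge1$ is a capacitated graph $(H,c_H)$ on vertex set $K$ such that (a) any feasible $K$-flow in $G$ can be feasibly routed in $H$, and (b) any feasible $K$-flow in $H$ can be routed in $G$ with congestion at most $\rho$; saying that the quality is at least $\rho_0$ means that (b) fails for every $\rho<\rho_0$. For a graph $G=(V,E)$ with capacities $c$ and a map $f:V\to K$ with $f(x)=x$ for all $x\in K$, the associated $0$-extension graph is the capacitated graph on $K$ in which distinct $s,t\in K$ have capacity equal to the sum of $c(e)$ over all edges $e=(u,v)\in E$ with $\{f(u),f(v)\}=\{s,t\}$. A convex combination $\sum_i\lambda_iH_i$ (with $\lambda_i\ge0$, $\sum_i\lambda_i=1$) of such graphs is the capacitated graph on $K$ with capacity function $\sum_i\lambda_ic_{H_i}$. The $\Omega(\cdot)$ hides an absolute positive constant independent of $k$. *)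

(* Defs.v *)
From HB Require Import structures.
From mathcomp Require Import all_boot all_order all_algebra.
From mathcomp Require Import all_classical all_reals exp.
Set Implicit Arguments.
Unset Strict Implicit.
Unset Printing Implicit Defensive.
Import Order.TTheory GRing.Theory Num.Theory.
Local Open Scope ring_scope.

Definition pairs (T : finType) (A : {set T}) : {set {set T}} :=
  [set a : {set T} | (a \subset A) && (#|a| == 2)%N].

(* An undirected edge is a two-element set of vertices; only the values of
   [cap] on [edges] are meaningful. Vertices live in an ambient finite type, so
   that a graph and its sparsifier share the same terminals. *)
Record cgraph (R : realType) (T : finType) := CGraph {
  verts : {set T};
  edges : {set {set T}};
  cap : {set T} -> R;
  edges_sub : edges \subset pairs verts;
  cap_ge0 : forall e : {set T}, e \in edges -> 0 <= cap e
}.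

Record demands (R : realType) (T : finType) := Demands {
  ncom : nat;
  src : 'I_ncom -> T;
  snk : 'I_ncom -> T;
  amount : 'I_ncom -> R
}.

Definition K_demands (R : realType) (T : finType) (K : {set T})
    (D : demands R T) : Prop :=
  forall i : 'I_(ncom D),
    [/\ src i \in K, snk i \in K, src i != snk i & 0 <= amount i].

(* [f i u v] is the amount of commodity [i] sent along the edge {u, v} in the
   direction from [u] to [v]. *)
Definition is_flow (R : realType) (T : finType) (G : cgraph R T)
    (D : demands R T) (f : 'I_(ncom D) -> T -> T -> R) : Prop :=
  [/\ forall i u v, 0 <= f i u v,
      forall i u v, [set u; v] \notin edges G -> f i u v = 0
    & forall i v, \sum_(w : T) f i v w - \sum_(w : T) f i w v =
        amount i * ((v == src i)%:R - (v == snk i)%:R)].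

Definition has_congestion (R : realType) (T : finType) (G : cgraph R T)
    (n : nat) (f : 'I_n -> T -> T -> R) (rho : R) : Prop :=
  forall u v : T, [set u; v] \in edges G ->
    \sum_(i < n) (f i u v + f i v u) <= rho * cap G [set u; v].

Definition routable (R : realType) (T : finType) (G : cgraph R T)
    (D : demands R T) (rho : R) : Prop :=
  exists f : 'I_(ncom D) -> T -> T -> R,
    is_flow G f /\ has_congestion G f rho.

(* To route in [G2] a flow given in [G1] is to find a flow in [G2] with the same
   sources, sinks and amounts. Feasible means congestion 1. *)
Definition K_flows_routable (R : realType) (T : finType) (K : {set T})
    (G1 G2 : cgraph R T) (rho : R) : Prop :=
  forall D : demands R T,
    K_demands K D -> routable G1 D 1 -> routable G2 D rho.

Definition flow_sparsifier (R : realType) (T : finType) (G : cgraph R T)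
    (K : {set T}) (H : cgraph R T) (rho : R) : Prop :=
  [/\ 1 <= rho, verts H = K, K_flows_routable K G H 1
    & K_flows_routable K H G rho].

Definition quality_at_least (R : realType) (T : finType) (G : cgraph R T)
    (K : {set T}) (H : cgraph R T) (rho0 : R) : Prop :=
  forall rho : R, rho < rho0 -> ~ K_flows_routable K H G rho.

Definition retraction (R : realType) (T : finType) (G : cgraph R T)
    (K : {set T}) (f : T -> T) : Prop :=
  (forall x, x \in verts G -> f x \in K) /\ (forall x, x \in K -> f x = x).

(* For an edge e = {u, v}, the image [f @: e] is {f u, f v}. *)
Definition zero_ext_cap (R : realType) (T : finType) (G : cgraph R T)
    (f : T -> T) (a : {set T}) : R :=
  \sum_(e in edges G | f @: e == a) cap G e.

Lemma zero_ext_cap_ge0 (R : realType) (T : finType) (G : cgraph R T)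
    (f : T -> T) (a : {set T}) : 0 <= zero_ext_cap G f a.
Proof. by apply: sumr_ge0 => e /andP[eG _]; exact: cap_ge0. Qed.

Definition zero_ext (R : realType) (T : finType) (G : cgraph R T)
    (K : {set T}) (f : T -> T) : cgraph R T :=
  CGraph (subxx (pairs K)) (fun a _ => zero_ext_cap_ge0 G f a).

Definition convex_zero_ext (R : realType) (T : finType) (G : cgraph R T)
    (K : {set T}) (H : cgraph R T) : Prop :=
  exists (n : nat) (lambda : 'I_n -> R) (f : 'I_n -> T -> T),
    [/\ forall i, 0 <= lambda i, \sum_(i < n) lambda i = 1,
        forall i, retraction G K (f i), verts H = K /\ edges H = pairs K
      & forall a, a \in pairs K ->
          cap H a = \sum_(i < n) lambda i * cap (zero_ext G K (f i)) a].

(* Main.v *)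
(** The demands "each edge of H carries its own capacity" are feasible in H, so
    by weak duality it suffices to find lengths on G under which every
    0-extension has large cost compared with the total capacity-weighted length.
    As in the Calinescu-Karloff-Rabani integrality gap, G is an expander on n
    vertices whose vertices each carry a pendant terminal at distance
    L of order sqrt(log n). A 0-extension either has all its fibres of size at most
    n / 2, and then expansion forces it to cut a constant fraction of the edges,
    each at cost at least 2 L, or it sends half of the vertices to a single
    terminal, and then a constant fraction of the pendant edges is stretched
    to length of order log n.
    The expander is the Cayley graph of F_2^m for a random family of O(m)
    generators: such a family is a good linear code, and its minimum distance is
    the spectral gap. Its degree is logarithmic, but only the ratio of degree to
    spectral gap matters, since the pendant capacities can be scaled
    accordingly. *)

Require Import Defs.
From mathcomp Require Import all_boot all_order all_algebra.
From mathcomp Require Import all_classical all_reals exp.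
From mathcomp Require Import ring lra.
Import Order.TTheory GRing.Theory Num.Theory.
Local Open Scope ring_scope.

(** * Fourier analysis on F_2^m and expansion of Cayley graphs *)

Notation cube m := {ffun 'I_m -> bool}.

Definition dot m (a x : cube m) : bool := \sum_j a j * x j.

Lemma dotC m (a x : cube m) : dot m a x = dot m x a.
Proof. by apply: eq_bigr => j _; rewrite mulrC. Qed.

Lemma dotDr m (a x y : cube m) : dot m a (x + y) = dot m a x (+) dot m a y.
Proof.
rewrite /dot -[RHS]/((_ : bool) + _) -big_split.
by apply: eq_bigr => j _; rewrite ffunE mulrDr.
Qed.

Lemma cube_addvv m (x : cube m) : x + x = 0.
Proof. by apply/ffunP => j; rewrite !ffunE -[_ + _]/(_ (+) _) addbb. Qed.

Lemma cube_addKv m (x y : cube m) : x + y + y = x.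
Proof. by rewrite -addrA cube_addvv addr0. Qed.

Lemma cube_opp m (x : cube m) : - x = x.
Proof. by apply/eqP; rewrite eq_sym -addr_eq0 cube_addvv. Qed.

Lemma dot_neq0 m (x : cube m) : x != 0 -> exists a, dot m a x.
Proof.
move=> xn0; have [j xj] : exists j, x j.
  apply/existsP; apply: contraR xn0 => /existsPn xn.
  by apply/eqP/ffunP => j; rewrite ffunE; apply: negbTE.
exists [ffun i => i == j]; rewrite /dot (bigD1 j) //= ffunE eqxx mul1r xj.
rewrite big1 ?addr0 // => i ij; by rewrite ffunE (negbTE ij) mul0r.
Qed.

Definition chi (R : realType) m (a x : cube m) : R := (-1) ^+ dot m a x.
Arguments chi R {m} a x.
Arguments dot {m} a x.

Lemma chiC (R : realType) m (a x : cube m) : chi R a x = chi R x a.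
Proof. by rewrite /chi dotC. Qed.

Lemma chiD (R : realType) m (a x y : cube m) :
  chi R a (x + y) = chi R a x * chi R a y.
Proof. by rewrite /chi dotDr signr_addb. Qed.

Lemma chi0 (R : realType) m (x : cube m) : chi R 0 x = 1.
Proof. by rewrite /chi /dot big1 // => j _; rewrite ffunE mul0r. Qed.

Lemma sum_chi (R : realType) m (x : cube m) :
  \sum_a chi R a x = (2 ^ m)%:R * (x == 0)%:R.
Proof.
have [->|xn0] := eqVneq x 0.
  under eq_bigr do rewrite chiC chi0.
  by rewrite sumr_const mulr1 -cardsT cardsT card_ffun card_bool card_ord.
have [b bx] := dot_neq0 _ _ xn0.
(* Translation by [b] permutes the summands and flips every sign, so the sum equals its own
   negative. *)
have : \sum_a chi R a x = - \sum_a chi R a x.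
  rewrite {1}(reindex_inj (addrI b)) -sumrN; apply: eq_bigr => a _.
  by rewrite !(chiC _ _ _ x) chiD {1}/chi dotC bx mulN1r.
by rewrite mulr0; lra.
Qed.

Definition fourier (R : realType) m (f : cube m -> R) (a : cube m) : R :=
  \sum_x f x * chi R a x.
Arguments fourier {R m} f a.

Lemma parseval (R : realType) m (f : cube m -> R) :
  \sum_a fourier f a ^+ 2 = (2 ^ m)%:R * \sum_x f x ^+ 2.
Proof.
under eq_bigr => a _ do rewrite expr2 /fourier mulr_suml.
rewrite exchange_big /= mulr_sumr; apply: eq_bigr => x _.
under eq_bigr => a _ do rewrite mulr_sumr.
rewrite exchange_big /= (bigD1 x) //= [X in _ + X]big1 => [|y yx].
  under eq_bigr => a _ do rewrite mulrACA -expr2 -expr2 sqrr_sign mulr1.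
  rewrite sumr_const card_ffun card_bool card_ord addr0.
  by rewrite mulr_natl.
under eq_bigr => a _ do rewrite mulrACA -chiD.
by rewrite -mulr_sumr sum_chi addr_eq0 cube_opp eq_sym (negbTE yx) !mulr0.
Qed.

(** A shift by [v] multiplies the coefficient at [a] by [chi R a v], and one minus this sign is 0 or
    2 according to [dot a v]. *)
Lemma fourier_shift (R : realType) m (f : cube m -> R) (v a : cube m) :
  fourier (fun x => f x - f (x + v)) a = 2 * (dot a v)%:R * fourier f a.
Proof.
rewrite /fourier; under eq_bigr do rewrite mulrBl.
rewrite big_split sumrN /= [X in _ - X](reindex_inj (addIr v)) /=.
under [X in _ - X]eq_bigr do rewrite cube_addKv chiD mulrA.
rewrite -mulr_suml /chi; case: (dot a v); rewrite /= ?expr1 ?expr0; ring.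
Qed.

(* The characters diagonalise the quadratic form on the right, and the
   nontrivial ones have eigenvalue at least [4 r]. *)
Lemma cayley_expansion (R : realType) m d (g : 'I_d -> cube m) (r : nat)
    (S : {set cube m}) :
  (forall a : cube m, a != 0 -> (r <= #|[set i | dot a (g i)]|)%N) ->
  4 * r%:R * (#|S|%:R - #|S|%:R ^+ 2 / (2 ^ m)%:R) <=
  \sum_i \sum_x ((x \in S) != (x + g i \in S))%:R :> R.
Proof.
move=> gr; set n : R := (2 ^ m)%:R.
have n0 : 0 < n by rewrite ltr0n expn_gt0.
pose f (x : cube m) : R := (x \in S)%:R.
have sumf : \sum_x f x = #|S|%:R.
  rewrite -sum1_card natr_sum [RHS]big_mkcond /=.
  by apply: eq_bigr => x _; rewrite /f; case: (x \in S).
have sumf2 : \sum_x f x ^+ 2 = #|S|%:R.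
  rewrite -sumf; apply: eq_bigr => x _; rewrite /f.
  by case: (x \in S); rewrite ?expr1n ?expr0n.
have f0 : fourier f 0 = #|S|%:R.
  by rewrite -sumf; apply: eq_bigr => x _; rewrite chi0 mulr1.
(* The indicator of a cut edge is the square of [f x - f (x + g i)], so Parseval applies; the factor
   4 is the square of the 2 in [fourier_shift]. *)
have cutE i : \sum_x ((x \in S) != (x + g i \in S))%:R =
    n^-1 * \sum_a 4 * (dot a (g i))%:R * fourier f a ^+ 2.
  have /(congr1 (fun z => n^-1 * z)) := parseval R m (fun x => f x - f (x + g i)).
  rewrite -/n mulrA mulVf ?gt_eqF // mul1r => E.
  transitivity (\sum_x (f x - f (x + g i)) ^+ 2).
    by apply: eq_bigr => x _; rewrite /f; do 2! case: (_ \in S) => /=; ring.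
  rewrite -E; congr (_ * _); apply: eq_bigr => a _.
  by rewrite fourier_shift; case: (dot a _) => /=; ring.
under eq_bigr do rewrite cutE.
rewrite -mulr_sumr exchange_big /=.
under eq_bigr => a _ do rewrite -mulr_suml -mulr_sumr.
(* The weight at each nonzero [a] is four times that of its codeword, hence at least [4 r]; the term
   at 0 is dropped as nonnegative. *)
have low : 4 * r%:R * (\sum_(a : cube m | a != 0) fourier f a ^+ 2) <=
    \sum_a 4 * (\sum_i (dot a (g i))%:R) * fourier f a ^+ 2.
  rewrite mulr_sumr [leRHS](bigID (fun a : cube m => a != 0)) /= -[leLHS]addr0.
  apply: lerD; last first.
    apply: sumr_ge0 => a _; rewrite mulr_ge0 ?sqr_ge0 // mulr_ge0 //.
    exact: sumr_ge0.
  apply: ler_sum => a an0; rewrite ler_wpM2r ?sqr_ge0 // ler_wpM2l //.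
  rewrite -natr_sum ler_nat; apply: leq_trans (gr a an0) _.
  rewrite -sum1_card big_mkcond /=.
  by apply: leq_sum => i _; rewrite inE; case: dot.
(* Removing the trivial coefficient from Parseval leaves [n |S| - |S|^2] for the nontrivial ones. *)
have := parseval R m f; rewrite -/n sumf2 (bigD1 (0 : cube m)) //= f0 => E.
have -> : 4 * r%:R * (#|S|%:R - #|S|%:R ^+ 2 / n) =
   n^-1 * (4 * r%:R * \sum_(a : cube m | a != 0) fourier f a ^+ 2).
  have -> : \sum_(a : cube m | a != 0) fourier f a ^+ 2 =
      n * #|S|%:R - #|S|%:R ^+ 2 by lra.
  by field; rewrite gt_eqF.
by rewrite ler_wpM2l // invr_ge0 ltW.
Qed.

(** * Random linear codes *)

Lemma sum_exp_card (R : realType) (I : finType) (x : R) :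
  \sum_(J : {set I}) x ^+ #|J| = (x + 1) ^+ #|I|.
Proof.
rewrite -prodr_const bigA_distr /=; apply: eq_bigr => J _.
by rewrite -big_mkcond /= prodr_const.
Qed.

(* Markov's inequality for [8 ^- #|J|]. *)
Lemma card_small_subsets (R : realType) (r : nat) :
  #|[set J : {set 'I_(20 * r)} | (#|J| < r)%N]|%:R <= (128 : R) ^+ r.
Proof.
have c : (8^-1 + 1 : R) ^+ 20 <= 16.
  have c5 : (8^-1 + 1 : R) ^+ 5 <= 2 by lra.
  rewrite (exprM _ 5 4); apply: le_trans (_ : 2 ^+ 4 <= _); last by lra.
  by apply: lerXn2r => //; rewrite nnegrE; lra.
rewrite -sum1_card natr_sum; pose x : R := 8^-1.
(* For each unit of [r], the factor 8 pays for Markov's inequality and 16 bounds [(9/8)^20]. *)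
have -> : (128 : R) = 8 * 16 by ring.
rewrite exprMn.
apply: le_trans (_ : 8 ^+ r * (\sum_(J : {set 'I_(20 * r)}) x ^+ #|J|) <= _).
  rewrite mulr_sumr big_mkcond; apply: ler_sum => J _; rewrite inE.
  case: ltnP => [Jr|_]; last by rewrite mulr_ge0 // exprn_ge0 // invr_ge0.
  rewrite /x exprVn -expfB // exprn_ege1 //; lra.
rewrite ler_wpM2l ?exprn_ge0 // sum_exp_card card_ord exprM.
by apply: lerXn2r => //; rewrite nnegrE ?exprn_ge0 // /x; lra.
Qed.

(** The weight is an affine function of the character of [a], and a nontrivial character sums to
    zero. *)
Lemma sum_dot_weight (R : realType) m (a : cube m) : a != 0 ->
  \sum_v (8^-1 : R) ^+ dot a v = 9 / 16 * (2 ^ m)%:R.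
Proof.
move=> an0; transitivity (\sum_v (9 / 16 + 7 / 16 * chi R v a)).
  apply: eq_bigr => v _; rewrite chiC /chi.
  by case: dot; rewrite /= ?expr1 ?expr0; lra.
rewrite big_split /= -[X in _ + X]mulr_sumr sum_chi (negbTE an0) !mulr0 addr0.
by rewrite sumr_const card_ffun card_bool card_ord mulr_natr.
Qed.

(* Gilbert-Varshamov: a random choice of [g] is good. *)
Lemma good_code (R : realType) (r : nat) : (0 < r)%N ->
  exists g : {ffun 'I_(20 * r) -> cube (10 * r)},
    forall a : cube (10 * r), a != 0 -> (r <= #|[set i | dot a (g i)]|)%N.
Proof.
move=> r0; pose n : R := (2 ^ (10 * r))%:R.
have n0 : 0 < n by rewrite ltr0n expn_gt0.
apply: contrapT => /forallNP bad.
(* A bad [g] has a nonzero [a] whose codeword has weight below [r]; that term alone is at least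
   1. *)
have {}bad (g : {ffun 'I_(20 * r) -> cube (10 * r)}) :
    1 <= \sum_(a : cube (10 * r) | a != 0)
           8 ^+ r * \prod_i (8^-1 : R) ^+ dot a (g i).
  have /existsNP[a /not_implyP[an0 /negP]] := bad g.
  rewrite -ltnNge => aw; rewrite (bigD1 a) //= ler_wpDr //.
    apply: sumr_ge0 => b _; rewrite mulr_ge0 ?exprn_ge0 //.
    by apply: prodr_ge0 => i _; rewrite exprn_ge0 // invr_ge0.
  rewrite -expr_sum.
  have -> : (\sum_i dot a (g i))%N = #|[set i | dot a (g i)]|.
    rewrite -sum1_card [RHS]big_mkcond /=.
    by apply: eq_bigr => i _; rewrite inE; case: dot.
  by rewrite exprVn -expfB // exprn_ege1 //; lra.
(* Sum the bound over all [g]. For fixed [a] the coordinates of [g] are independent, so the sum of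
   products factors into [20 r] equal sums. *)
have : n ^+ (20 * r) <= n * (8 ^+ r * (9 / 16 * n) ^+ (20 * r)).
  have -> : n ^+ (20 * r) = \sum_(g : {ffun 'I_(20 * r) -> cube (10 * r)}) 1.
    by rewrite sumr_const !card_ffun card_bool !card_ord -natrX.
  apply: le_trans (ler_sum _ (fun g _ => bad g)) _.
  rewrite exchange_big /=.
  apply: le_trans (_ : \sum_(a : cube (10 * r))
      8 ^+ r * (9 / 16 * n) ^+ (20 * r) <= _); last first.
    by rewrite sumr_const card_ffun card_bool !card_ord -[leLHS]mulr_natl.
  rewrite big_mkcond; apply: ler_sum => a _; case: ifP => [an0|_]; last first.
    by rewrite mulr_ge0 ?exprn_ge0 //; lra.
  rewrite -mulr_sumr ler_wpM2l ?exprn_ge0 //.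
  rewrite -(bigA_distr_bigA (fun i v => 8^-1 ^+ dot a v)) /=.
  by rewrite prodr_const card_ord sum_dot_weight.
have -> : n * (8 ^+ r * (9 / 16 * n) ^+ (20 * r)) =
    (n * (8 ^+ r * (9 / 16) ^+ (20 * r))) * n ^+ (20 * r).
  by rewrite [(_ * n) ^+ _]exprMn !mulrA.
rewrite -[leLHS]mul1r ler_pM2r ?exprn_gt0 //.
apply/negP; rewrite -ltNge.
(* The contradiction holds per unit of [r]: [2^10 * 8 * 16^-4 = 1/8 < 1]. *)
have -> : n = (2 ^+ 10) ^+ r by rewrite /n natrX exprM.
have c5 : (9 / 16 : R) ^+ 5 <= 16^-1 by lra.
have c : (9 / 16 : R) ^+ 20 <= 16^-1 ^+ 4.
  rewrite (exprM _ 5 4).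
  by apply: lerXn2r => //; rewrite nnegrE; lra.
rewrite [(9 / 16) ^+ _]exprM -!exprMn exprn_ilt1 -?lt0n //; last lra.
by rewrite !mulr_ge0 ?exprn_ge0 //; lra.
Qed.

(** * Truncated word length *)

(* Word length of [z] with respect to the [g i], truncated at [r]; the
   truncation spares proving that the [g i] generate. *)
Definition wlen m d (g : 'I_d -> cube m) (r : nat) (z : cube m) : nat :=
  \big[Order.min/r]_(J : {set 'I_d} | \sum_(i in J) g i == z) #|J|.
Arguments wlen {m d} g r z.

Lemma wlen0 m d (g : 'I_d -> cube m) r : wlen g r 0 = 0%N.
Proof.
apply/eqP; rewrite -leqn0 -(cards0 'I_d) -leEnat.
by apply: bigmin_le_cond; rewrite big_set0.
Qed.

(** Toggling [i] in [J] adds [g i] to the subset sum, in characteristic 2, and enlarges [J] by at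
    most one element. *)
Lemma wlenD_gen m d (g : 'I_d -> cube m) r (z : cube m) i :
  (wlen g r (z + g i)%R <= (wlen g r z).+1)%N.
Proof.
(* With the successor moved to the left, the goal is a lower bound for a minimum, to be checked on
   the default [r] and on each [J]. *)
suff : ((wlen g r (z + g i)%R).-1 <= wlen g r z)%N by case: (wlen g r (z + g i)%R).
rewrite -leEnat; apply/bigmin_geP; split.
  rewrite leEnat; apply: leq_trans (leq_pred _) _.
  by rewrite -leEnat; apply: bigmin_le_id.
move=> J /eqP sJ; rewrite leEnat.
have [iJ|iJ] := boolP (i \in J).
  apply: leq_trans (leq_pred _) _.
  apply: leq_trans (subset_leq_card (subsetDl J [set i])).
  rewrite -leEnat; apply: bigmin_le_cond; rewrite -sJ (big_setD1 i iJ) /=.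
  by rewrite [g i + _]addrC cube_addKv.
rewrite -subn1 leq_subLR add1n -(add1n #|J|).
have -> : (1 + #|J|)%N = #|i |: J| by rewrite cardsU1 iJ.
by rewrite -leEnat; apply: bigmin_le_cond; rewrite big_setU1 //= sJ addrC.
Qed.

Lemma wlen_gen m d (g : 'I_d -> cube m) r (z : cube m) i :
  (wlen g r z <= (wlen g r (z + g i)%R).+1)%N.
Proof. by rewrite -{1}(cube_addKv _ z (g i)) wlenD_gen. Qed.

(** Each element of word length below [r] is the sum over some [J] with fewer than [r] elements, so
    there are at most as many as such [J]; all other elements of [S] contribute [r]. *)
Lemma wlen_ge m d (g : 'I_d -> cube m) r (S : {set cube m}) :
  (r * (#|S| - #|[set J : {set 'I_d} | (#|J| < r)%N]|) <= \sum_(z in S) wlen g r z)%N.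
Proof.
set B := [set J | _]; pose N := [set z | (wlen g r z < r)%N].
have NB : (#|N| <= #|B|)%N.
  apply: leq_trans (leq_imset_card (fun J : {set 'I_d} => \sum_(i in J) g i) _).
  apply/subset_leq_card/fintype.subsetP => z; rewrite inE => zr; apply/imsetP.
  apply: contrapT => noJ; move: zr; rewrite ltnNge => /negP; apply.
  rewrite -leEnat; apply/bigmin_geP; split => // J /eqP sJ; rewrite leEnat.
  rewrite leqNgt; apply/negP => Jr; apply: noJ; exists J => //.
  by rewrite inE.
apply: (@leq_trans (r * #|S :\: N|)).
  rewrite leq_mul2l cardsD; apply/orP; right; apply: leq_sub2l.
  exact: leq_trans (subset_leq_card (subsetIr _ _)) NB.
rewrite (bigID (mem N)) /=; apply: leq_trans (leq_addl _ _).
rewrite mulnC -sum_nat_const.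
rewrite [leqRHS](eq_bigl (mem (S :\: N))) => [|z]; last by rewrite !inE andbC.
by apply: leq_sum => z; rewrite !inE -leqNgt => /andP[].
Qed.

(** * Duality between flows and lengths *)

Lemma eq_set2 (T : finType) (u v a b : T) :
  ([set u; v] == [set a; b]) = ((u == a) && (v == b)) || ((u == b) && (v == a)).
Proof.
apply/eqP/idP => [e|/orP[]/andP[/eqP-> /eqP->] //]; last exact: finset.setUC.
have : u \in [set a; b] by rewrite -e !inE eqxx.
have : v \in [set a; b] by rewrite -e !inE eqxx orbT.
have : a \in [set u; v] by rewrite e !inE eqxx.
have : b \in [set u; v] by rewrite e !inE eqxx orbT.
rewrite !inE (eq_sym b) (eq_sym b v) (eq_sym a u) (eq_sym a v).
by do 4! case: (_ == _).
Qed.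

Lemma sum_eq_set2 (R : realType) (T : finType) (F : T -> T -> R) a b :
  a != b ->
  \sum_u \sum_(v | [set u; v] == [set a; b]) F u v = F a b + F b a.
Proof.
move=> ab; rewrite (bigD1 a) //= [X in _ + X](bigD1 b) 1?eq_sym //=.
rewrite (big_pred1 b) => [|v]; last by rewrite eq_set2 eqxx (negbTE ab) /= orbF.
rewrite (big_pred1 a) => [|v]; last first.
  by rewrite eq_set2 eqxx [b == a]eq_sym (negbTE ab).
rewrite big1 ?addr0 // => u /andP[ua ub]; rewrite big_pred0 // => v.
by rewrite eq_set2 (negbTE ua) (negbTE ub).
Qed.

Lemma set2_pairs (T : finType) (A : {set T}) u v :
  ([set u; v] \in pairs A) = [&& u \in A, v \in A & u != v].
Proof. by rewrite inE finset.subUset !finset.sub1set cards2 eqSS eqb1 andbA. Qed.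

Lemma pairsP (T : finType) (A : {set T}) e : e \in pairs A ->
  exists u v, [/\ e = [set u; v], u \in A, v \in A & u != v].
Proof.
move=> eA; have := eA; rewrite inE => /andP[_ /cards2P[u [v [_ e2]]]].
by move: eA; rewrite e2 set2_pairs => /and3P[]; exists u, v.
Qed.

(* Weak duality between concurrent flows and lengths, with the distance from
   the source of each commodity relaxed to a 1-Lipschitz potential. *)
Lemma routing_duality (R : realType) (T : finType) (G : cgraph R T)
    (D : demands R T) (rho : R) (phi : 'I_(ncom D) -> T -> R)
    (len : {set T} -> R) :
  (forall e, e \in edges G -> 0 <= len e) ->
  (forall i u v, [set u; v] \in edges G -> phi i v - phi i u <= len [set u; v]) ->
  routable G D rho ->
  \sum_i amount i * (phi i (snk i) - phi i (src i)) <=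
  rho * \sum_(e in edges G) cap G e * len e.
Proof.
move=> len0 lip [f [[f0 fE fcons] fcong]].
(* Summation by parts: flow conservation turns the potential drop of a commodity into a sum over the
   arcs that carry it. *)
have flowE i : amount i * (phi i (snk i) - phi i (src i)) =
    \sum_u \sum_v f i u v * (phi i v - phi i u).
  under [RHS]eq_bigr do under eq_bigr do rewrite mulrBr.
  under [RHS]eq_bigr do rewrite big_split sumrN /=.
  rewrite big_split sumrN /= exchange_big /= -sumrB.
  transitivity (\sum_v phi i v * (amount i * ((v == snk i)%:R - (v == src i)%:R))).
    under eq_bigr do rewrite mulrCA.
    rewrite -mulr_sumr; congr (_ * _).
    under eq_bigr do rewrite mulrBr.
    have pick t : \sum_v phi i v * (v == t)%:R = phi i t.
      rewrite (bigD1 t) //= eqxx mulr1 big1 ?addr0 // => v /negbTE ->.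
      by rewrite mulr0.
    by rewrite big_split sumrN /= !pick.
  apply: eq_bigr => v _.
  have -> : amount i * ((v == snk i)%:R - (v == src i)%:R) =
    - (\sum_w f i v w - \sum_w f i w v) by rewrite fcons -mulrN opprB.
  by rewrite opprB mulrBr !mulr_sumr; congr (_ - _); apply: eq_bigr => w _; rewrite mulrC.
rewrite (eq_bigr _ (fun i _ => flowE i)).
(* Arcs are grouped by their undirected edge, since the congestion bound concerns both directions
   together. *)
apply: le_trans (_ : \sum_(e in edges G) \sum_u \sum_(v | [set u; v] == e)
   (\sum_i f i u v) * len e <= _); last first.
  rewrite mulr_sumr; apply: ler_sum => e eG.
  have [u [v [e2 _ _ uv]]] := pairsP _ _ _ (fintype.subsetP (edges_sub G) e eG).
  rewrite e2 (sum_eq_set2 R T (fun a b => (\sum_i f i a b) * len [set u; v])) //.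
  rewrite -mulrDl -big_split mulrA /= ler_wpM2r -?e2 ?len0 //.
  by rewrite e2; apply: fcong; rewrite -e2.
rewrite [leLHS]exchange_big /= [leRHS]exchange_big /=; apply: ler_sum => u _.
rewrite [leLHS]exchange_big /= [leRHS](exchange_big_dep predT) //=; apply: ler_sum => v _.
have [uvG|uvG] := boolP ([set u; v] \in edges G); last first.
  rewrite big1 => [|i _]; last by rewrite fE // mul0r.
  apply: sumr_ge0 => e /andP[eG /eqP e2]; by rewrite e2 eG in uvG.
rewrite (big_pred1 [set u; v]) => [|e]; last first.
  by rewrite /= andbC eq_sym; case: eqP => [->|].
by rewrite mulr_suml; apply: ler_sum => i _; rewrite ler_wpM2l // lip.
Qed.

(** * Congestion of convex combinations of 0-extensions *)

Definition ordered_pairs (T : finType) (K : {set T}) : {set T * T} :=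
  [set p | [&& p.1 \in K, p.2 \in K & p.1 != p.2]].

(* Each edge yields two ordered pairs, hence the division by 2. *)
Definition self_demands (R : realType) (T : finType) (K : {set T})
    (H : cgraph R T) : demands R T :=
  @Demands R T #|ordered_pairs T K| (fun i => (enum_val i).1)
    (fun i => (enum_val i).2)
    (fun i => cap H [set (enum_val i).1; (enum_val i).2] / 2).

Lemma self_demands_K (R : realType) (T : finType) (K : {set T})
    (H : cgraph R T) : edges H = pairs K -> K_demands K (self_demands R T K H).
Proof.
move=> HK i /=; have := enum_valP i; rewrite inE => /and3P[sK tK st].
by split=> //; rewrite divr_ge0 // cap_ge0 // HK set2_pairs sK tK.
Qed.

(** Send each commodity straight along its own edge; the two orientations together fill the edge
    exactly. *)
Lemma self_demands_routable (R : realType) (T : finType) (K : {set T})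
    (H : cgraph R T) : edges H = pairs K -> routable H (self_demands R T K H) 1.
Proof.
move=> HK; pose c (p : T * T) := cap H [set p.1; p.2] / 2.
have c0 p : p \in ordered_pairs T K -> 0 <= c p.
  rewrite inE => /and3P[sK tK st].
  by rewrite divr_ge0 // cap_ge0 // HK set2_pairs sK tK.
exists (fun i u v => c (enum_val i) * ((u, v) == enum_val i)%:R); split; first split.
- by move=> i u v; rewrite mulr_ge0 // c0 // enum_valP.
- move=> i u v uvK; case: eqP => [e|_]; last by rewrite mulr0.
  have := enum_valP i; rewrite -e inE /= => uvP.
  by rewrite HK set2_pairs uvP in uvK.
- move=> i v /=; rewrite -!mulr_sumr -mulrBr; congr (_ * (_ - _)).
    rewrite (bigD1 (enum_val i).2) //= big1 ?addr0 => [|w /negbTE wn].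
      by case: (enum_val i) => a b; rewrite xpair_eqE eqxx andbT.
    by move: wn; case: (enum_val i) => a b /= wn; rewrite xpair_eqE wn andbF.
  rewrite (bigD1 (enum_val i).1) //= big1 ?addr0 => [|w /negbTE wn].
    by case: (enum_val i) => a b; rewrite xpair_eqE eqxx.
  by move: wn; case: (enum_val i) => a b /= wn; rewrite xpair_eqE wn.
move=> u v; rewrite HK set2_pairs => /and3P[uK vK uv] /=.
have pick a b : a \in K -> b \in K -> a != b ->
    \sum_(i < #|ordered_pairs T K|) c (enum_val i) * ((a, b) == enum_val i)%:R = c (a, b).
  move=> aK bK ab.
  transitivity (\sum_(p in ordered_pairs T K) c p * ((a, b) == p)%:R).
    by rewrite [RHS]big_enum_val.
  rewrite (bigD1 (a, b)) ?inE /= ?aK ?bK //= eqxx mulr1 big1 ?addr0 //.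
  by move=> p /andP[_ pab]; rewrite eq_sym (negbTE pab) mulr0.
rewrite big_split /= !pick // 1?eq_sym // /c /= (finset.setUC [set v]); lra.
Qed.

Lemma self_demands_sum (R : realType) (T : finType) (K : {set T})
    (H : cgraph R T) (psi : T -> T -> R) (D := self_demands R T K H) :
  \sum_(i < ncom D) amount i * psi (src i) (snk i) =
  \sum_(p in ordered_pairs T K) cap H [set p.1; p.2] / 2 * psi p.1 p.2.
Proof. by rewrite [RHS]big_enum_val. Qed.

(** Duality is applied to the self-demands of [H]. Their cost is linear in the capacities of [H],
    hence an average of the costs of the 0-extensions, each at least [B]. *)
Lemma convex_zero_ext_congestion (R : realType) (T : finType) (G : cgraph R T)
    (K : {set T}) (H : cgraph R T) (rho B : R) (phi : T -> T -> R)
    (len : {set T} -> R) :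
  convex_zero_ext G K H -> K_flows_routable K H G rho ->
  (forall e, e \in edges G -> 0 <= len e) ->
  (forall s u v, s \in K -> [set u; v] \in edges G ->
     phi s v - phi s u <= len [set u; v]) ->
  (forall s, s \in K -> phi s s = 0) ->
  (forall f, retraction G K f -> B <=
     \sum_(p in ordered_pairs T K)
        zero_ext_cap G f [set p.1; p.2] / 2 * phi p.1 p.2) ->
  B <= rho * \sum_(e in edges G) cap G e * len e.
Proof.
move=> [n [lam [f [lam0 lam1 fret [_ HK] capH]]]] Hrho len0 lip phi0 costB.
have DK := self_demands_K _ _ _ _ HK.
have srcK (i : 'I_(ncom (self_demands R T K H))) : src i \in K by case: (DK i).
have DG := Hrho _ DK (self_demands_routable _ _ _ _ HK).
have := routing_duality _ _ _ _ _ (fun i v => phi (src i) v) len len0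
  (fun i u v => lip _ u v (srcK i)) DG.
apply: le_trans.
under eq_bigr do rewrite (phi0 _ (srcK _)) subr0.
rewrite self_demands_sum -[leLHS]mul1r -{1}lam1 mulr_suml.
under [leRHS]eq_bigr => p /[!inE] pK.
  rewrite capH ?set2_pairs // !mulr_suml; over.
rewrite exchange_big; apply: ler_sum => i _ /=.
under eq_bigr do rewrite -!mulrA.
rewrite -mulr_sumr ler_wpM2l //.
by under eq_bigr do rewrite mulrA; apply: costB.
Qed.

(** * Graphs given by an indexed family of edges *)

Section EdgeFamily.
Variables (R : realType) (T J : finType) (a b : J -> T) (w : J -> R).
Hypothesis w_ge0 : forall j, 0 <= w j.

Definition family_edges : {set {set T}} :=
  [set e in pairs [set: T] | [exists j, [set a j; b j] == e]].

Definition family_cap (e : {set T}) : R := \sum_(j | [set a j; b j] == e) w j.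

Lemma family_edges_sub : family_edges \subset pairs [set: T].
Proof. by apply/fintype.subsetP => e; rewrite inE => /andP[]. Qed.

Lemma family_cap_ge0 e : e \in family_edges -> 0 <= family_cap e.
Proof. by move=> _; apply: sumr_ge0. Qed.

(* Parallel members of the family add up, and loops disappear. *)
Definition family_graph : cgraph R T := CGraph family_edges_sub family_cap_ge0.

Lemma family_edge j :
  ([set a j; b j] \in family_edges) = (a j != b j).
Proof.
rewrite inE set2_pairs !finset.in_setT /=.
by case: (_ != _) => //=; apply/existsP; exists j.
Qed.

Lemma family_edgeP (e : {set T}) : e \in edges family_graph ->
  exists2 j, e = [set a j; b j] & a j != b j.
Proof.
move=> eG; have := eG; rewrite inE => /andP[_ /existsP[j /eqP je]].
by exists j; rewrite ?je // -family_edge je.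
Qed.

Lemma family_sum (F : {set T} -> R) :
  \sum_(e in edges family_graph) cap family_graph e * F e =
  \sum_(j | a j != b j) w j * F [set a j; b j].
Proof.
rewrite [RHS](partition_big (fun j => [set a j; b j]) (mem family_edges)) /=.
  apply: eq_bigr => e eG; rewrite mulr_suml [RHS]big_mkcond [LHS]big_mkcond.
  by apply: eq_bigr => j _; rewrite -family_edge; case: eqP => [->|]; rewrite ?eG ?andbF.
by move=> j jG; rewrite family_edge.
Qed.

(** The cost is regrouped by original edges: [f] moves the member [j] to the pair of images of its
    ends, and a collapsed pair costs nothing by [phi0]. Both orientations are averaged because [phi]
    may be asymmetric. *)
Lemma family_zero_ext_cost (K : {set T}) (f : T -> T) (phi : T -> T -> R) :
  retraction family_graph K f -> (forall s, s \in K -> phi s s = 0) ->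
  \sum_(p in ordered_pairs T K)
     zero_ext_cap family_graph f [set p.1; p.2] / 2 * phi p.1 p.2 =
  \sum_j w j * ((phi (f (a j)) (f (b j)) + phi (f (b j)) (f (a j))) / 2).
Proof.
move=> [fK _] phi0.
have {}fK x : f x \in K by rewrite fK ?finset.in_setT.
have imf j : f @: [set a j; b j] = [set f (a j); f (b j)].
  by rewrite imsetU1 imset_set1.
have capE p : p \in ordered_pairs T K ->
    zero_ext_cap family_graph f [set p.1; p.2] =
    \sum_j w j * ([set p.1; p.2] == [set f (a j); f (b j)])%:R.
  rewrite inE => /and3P[_ _ pp].
  rewrite /zero_ext_cap big_mkcondr /=.
  under eq_bigr do rewrite -mulrb -mulr_natr.
  rewrite (family_sum (fun e => (f @: e == [set p.1; p.2])%:R)) big_mkcond.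
  apply: eq_bigr => j _; rewrite imf [[set p.1; _] == _]eq_sym; case: eqVneq => //= e.
  (* A loop has a singleton image, which is never a pair of distinct terminals, so loops may join
     the sum over all [j]. *)
  rewrite e finset.setUid.
  case: eqP => [/esym/(congr1 (fun A : {set T} => #|A|))|]; last by rewrite mulr0.
  by rewrite cards2 cards1 pp.
transitivity (\sum_(p in ordered_pairs T K) \sum_j
    w j * ([set p.1; p.2] == [set f (a j); f (b j)])%:R / 2 * phi p.1 p.2).
  by apply: eq_bigr => p pK; rewrite capE // !mulr_suml.
rewrite exchange_big; apply: eq_bigr => j _ /=.
under eq_bigr do rewrite -!mulrA; rewrite -mulr_sumr; congr (_ * _).
have [e|ne] := eqVneq (f (a j)) (f (b j)).
  rewrite e phi0 // addr0 mul0r big1 // => p; rewrite inE => /and3P[_ _ pp].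
  case: eqP => [/(congr1 (fun A : {set T} => #|A|))|]; last by rewrite mul0r.
  by rewrite !cards2 pp eqxx.
rewrite -(sum_eq_set2 R T phi _ _ ne) pair_big_dep mulr_suml /=.
rewrite [RHS]big_mkcond [LHS]big_mkcond; apply: eq_bigr => p _.
have : ([set p.1; p.2] == [set f (a j); f (b j)]) -> p \in ordered_pairs T K.
  rewrite eq_set2 inE => /orP[]/andP[/eqP-> /eqP->]; rewrite !fK //.
  by rewrite eq_sym.
case: eqP => [_ -> //|_ _]; first by rewrite mul1r mulrC.
by rewrite mul0r; case: ifP.
Qed.

End EdgeFamily.

(** * Cost of rounding the cube to terminals *)

(** Here [h x] names the terminal that receives the cube vertex [x]. The first sum is the cost of
    cut cube edges, the second that of stretched pendant edges; a fibre of [h] larger than half the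
    cube makes the second large, otherwise expansion makes the first large. *)
Lemma rounding_cost (R : realType) m d (g : 'I_d -> cube m) (r : nat) (L : R)
    (h : cube m -> cube m) :
  0 <= L ->
  (forall a : cube m, a != 0 -> (r <= #|[set i | dot a (g i)]|)%N) ->
  4 * #|[set J : {set 'I_d} | (#|J| < r)%N]|%:R <= (2 ^ m)%:R :> R ->
  r%:R * (2 ^ m)%:R * L / 4 <=
  \sum_x \sum_i 2 * L * (h x != h (x + g i))%:R +
  L * \sum_x (wlen g r (h x + x))%:R.
Proof.
move=> L0 gr small; set n : R := (2 ^ m)%:R in small *.
have n0 : 0 < n by rewrite ltr0n expn_gt0.
pose S y := [set x | h x == y].
have cut0 : 0 <= \sum_x \sum_i 2 * L * (h x != h (x + g i))%:R.
  by do 2! apply: sumr_ge0 => ? _; rewrite !mulr_ge0.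
have tail0 : 0 <= \sum_x (wlen g r (h x + x))%:R :> R by apply: sumr_ge0.
have [[y big]|/forallNP small_fibres] := pselect (exists y, n < 2 * #|S y|%:R).
  (* The words [y + x] for [x] in the fibre are distinct and more than [n / 2] in number; at most
     [n / 4] of them are shorter than [r]. *)
  suff : r%:R * n / 4 <= \sum_x (wlen g r (h x + x))%:R :> R.
    by move=> /(ler_wpM2l L0); lra.
  have inj : injective (+%R y : cube m -> cube m) := addrI y.
  have := wlen_ge _ _ g r [set y + x | x in S y].
  rewrite card_imset // big_imset /=; last by move=> ? ? _ _; apply: inj.
  rewrite -(ler_nat R) natrM natr_sum => low.
  have : \sum_(x in S y) (wlen g r (y + x))%:R <= \sum_x (wlen g r (h x + x))%:R :> R.
    rewrite big_mkcond; apply: ler_sum => x _; rewrite inE.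
    by case: eqP => [->|].
  apply: le_trans; apply: le_trans low; rewrite -mulrA ler_wpM2l //.
  rewrite natrB; last by rewrite -(ler_nat R); lra.
  lra.
have {}small_fibres y : 2 * #|S y|%:R <= n by rewrite leNgt; apply/negP.
have sumS : \sum_y #|S y|%:R = n.
  have -> : n = \sum_(x : cube m) 1 by rewrite sumr_const card_ffun card_bool card_ord.
  rewrite [RHS](partition_big h predT) //=; apply: eq_bigr => y _.
  by rewrite -sum1_card natr_sum; apply: eq_bigl => x; rewrite inE.
(* A fibre [S] of size at most [n / 2] has [|S| - |S|^2 / n >= |S| / 2], so expansion gives it
   boundary [2 r |S|]. Summed over the fibres, each cut edge counts twice, once for the fibre of
   each end. *)
have : 2 * r%:R * n <= 2 * \sum_x \sum_i (h x != h (x + g i))%:R.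
  rewrite -sumS mulr_sumr.
  apply: le_trans (_ : \sum_y \sum_i \sum_x
      ((x \in S y) != (x + g i \in S y))%:R <= _).
    apply: ler_sum => y _; apply: le_trans (cayley_expansion R _ _ _ _ (S y) gr).
    rewrite -/n.
    have : #|S y|%:R ^+ 2 / n <= #|S y|%:R / 2 :> R.
      rewrite ler_pdivrMr // expr2 -mulrA ler_wpM2l //; have := small_fibres y; lra.
    have : 0 <= r%:R :> R by [].
    nra.
  rewrite [leLHS]exchange_big /= [leRHS]mulr_sumr.
  under [leLHS]eq_bigr do rewrite exchange_big /=.
  rewrite [leLHS]exchange_big /=.
  under [leRHS]eq_bigr do rewrite mulr_sumr.
  apply: ler_sum => x _; apply: ler_sum => i _.
  have pick (z : cube m) : \sum_y (z == y)%:R = 1 :> R.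
    rewrite (bigD1 z) //= eqxx big1 ?addr0 // => y; rewrite eq_sym => /negbTE ->.
    by [].
  case: eqVneq => [e|_] /=.
    by rewrite mulr0 big1 // => y _; rewrite !inE e eqxx.
  rewrite mulr1.
  apply: le_trans (_ : \sum_y ((h x == y)%:R + (h (x + g i) == y)%:R) <= _).
    by apply: ler_sum => y _; rewrite !inE; do 2! case: (_ == y) => /=; lra.
  by rewrite big_split /= !pick; lra.
have -> : \sum_x \sum_i 2 * L * (h x != h (x + g i))%:R =
    2 * L * \sum_x \sum_i (h x != h (x + g i))%:R.
  by rewrite mulr_sumr; apply: eq_bigr => x _; rewrite mulr_sumr.
move=> low; have := mulr_ge0 L0 tail0.
have : 0 <= r%:R * n * L by rewrite !mulr_ge0 // ltW.
have := ler_wpM2l L0 low; lra.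
Qed.

(** * The Cayley graph with pendant terminals *)

Section TailedCayleyGraph.
Variables (R : realType) (m d : nat) (g : 'I_d -> cube m) (r : nat) (L : R).
Hypothesis L_ge0 : 0 <= L.

Local Notation vert := (cube m + cube m)%type.
Local Notation edge_idx := (cube m * 'I_d + cube m)%type.

(** [inl] marks cube vertices and [inr] their pendant terminals. Cube edges are indexed from both
    ends, which doubles their capacity. *)
Definition end1 (j : edge_idx) : vert :=
  match j with inl p => inl p.1 | inr x => inl x end.

Definition end2 (j : edge_idx) : vert :=
  match j with inl p => inl (p.1 + g p.2) | inr x => inr x end.

(** Pendant edges get capacity [L] as well as length [L]: with [L ^+ 2 = r] they add [r] per vertex
    to the total length, comparable to the degree. *)
Definition weight (j : edge_idx) : R := if j is inr _ then L else 1.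

Lemma weight_ge0 j : 0 <= weight j.
Proof. by case: j. Qed.

Definition tailed_graph : cgraph R vert :=
  family_graph R vert _ end1 end2 weight weight_ge0.

Definition terminals : {set vert} := [set inr x | x in [set: cube m]].

Definition base (p : vert) : cube m := match p with inl x => x | inr x => x end.

Definition height (p : vert) : R := if p is inr _ then L else 0.

(** Graph distance for cube edges of length 1 and pendant edges of length [L], with word length
    truncated at [r]. The diagonal is set apart because the formula would give [2 L] at a
    terminal. *)
Definition tdist (p q : vert) : R :=
  if p == q then 0 else height p + height q + (wlen g r (base p + base q))%:R.

Definition tlen (e : {set vert}) : R := if [exists x, inr x \in e] then L else 1.

Lemma tdistC p q : tdist p q = tdist q p.
Proof. by rewrite /tdist eq_sym addrC (addrC (base p)) (addrC (height p)) addrC. Qed.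

Lemma tdist_terminals x y : tdist (inr x) (inr y) =
  if x == y then 0 else 2 * L + (wlen g r (x + y))%:R.
Proof.
rewrite /tdist /=; case: (eqVneq x y) => [->|/eqP xy]; first by rewrite eqxx.
by case: eqP => [[]//|_]; rewrite mulr2n mulrDl mul1r.
Qed.

Lemma tlen_end j : tlen [set end1 j; end2 j] = if j is inr _ then L else 1.
Proof.
rewrite /tlen; case: j => [[x i]|x] /=; case: existsP => //.
  by case=> z; rewrite !inE.
by case; exists x; rewrite !inE eqxx orbT.
Qed.

Lemma tlen_ge0 e : 0 <= tlen e.
Proof. by rewrite /tlen; case: ifP. Qed.

Lemma tdist_lip z j :
  `|tdist (inr z) (end2 j) - tdist (inr z) (end1 j)| <= tlen [set end1 j; end2 j].
Proof.
rewrite tlen_end /tdist; case: j => [[x i]|x] /=.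
  have A : (wlen g r (z + (x + g i)))%:R <= (wlen g r (z + x))%:R + 1 :> R.
    by rewrite natr1 ler_nat addrA wlenD_gen.
  have B : (wlen g r (z + x))%:R <= (wlen g r (z + (x + g i)))%:R + 1 :> R.
    by rewrite natr1 ler_nat addrA wlen_gen.
  by rewrite ler_norml; apply/andP; split; lra.
(* At the source's own pendant edge the distance drops from [L] to 0; at any other it rises by
   [L]. *)
case: eqP => [[->]|_].
  by rewrite cube_addvv wlen0 !addr0 sub0r normrN ger0_norm.
by rewrite addr0 opprD addrACA subrr addr0 addrK ger0_norm.
Qed.

Lemma tdist_edge s u v : s \in terminals -> [set u; v] \in edges tailed_graph ->
  tdist s v - tdist s u <= tlen [set u; v].
Proof.
move=> /imsetP[z _ ->] /family_edgeP[j e _]; have := tdist_lip z j.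
rewrite e ler_norml => /andP[A B]; move/eqP: e.
by rewrite eq_set2 => /orP[]/andP[/eqP-> /eqP->] //; lra.
Qed.

Lemma sum_tlen : L ^+ 2 = r%:R ->
  \sum_(e in edges tailed_graph) cap tailed_graph e * tlen e <=
  (2 ^ m)%:R * (d%:R + r%:R).
Proof.
move=> L2; rewrite family_sum.
apply: le_trans (_ : \sum_j weight j * tlen [set end1 j; end2 j] <= _).
  rewrite big_mkcond; apply: ler_sum => j _; case: ifP => // _.
  by rewrite mulr_ge0 ?weight_ge0 ?tlen_ge0.
under eq_bigr do rewrite tlen_end.
rewrite big_sumType /= !sumr_const card_prod card_ffun card_bool !card_ord.
by rewrite -(expr2 L) L2 mulr1 mulrDr -natrM -[_ *+ (2 ^ m)]mulr_natl.
Qed.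

Lemma tailed_zero_ext_cost (f : vert -> vert) :
  (forall a : cube m, a != 0 -> (r <= #|[set i | dot a (g i)]|)%N) ->
  4 * #|[set J : {set 'I_d} | (#|J| < r)%N]|%:R <= (2 ^ m)%:R :> R ->
  retraction tailed_graph terminals f ->
  r%:R * (2 ^ m)%:R * L / 4 <=
  \sum_(p in ordered_pairs vert terminals)
     zero_ext_cap tailed_graph f [set p.1; p.2] / 2 * tdist p.1 p.2.
Proof.
move=> gr small fret; rewrite family_zero_ext_cost //; last first.
  by move=> s _; rewrite /tdist eqxx.
have half (t : R) : (t + t) / 2 = t by lra.
under eq_bigr do rewrite (tdistC (f (end2 _))) half.
have [fK fid] := fret.
(* Terminals are fixed by [f], so [h] determines it: cube edges go to [h x], [h (x + g i)] and the
   pendant edge at [x] to [h x], [x]. Below, only [2 L] is kept of the former distance and only the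
   word length of the latter. *)
pose h x := base (f (inl x)).
have fh x : f (inl x) = inr (h x).
  have /imsetP[y _ e] := fK (inl x) (finset.in_setT _); by rewrite /h e.
have fr x : f (inr x) = inr x by apply: fid; apply: imset_f.
apply: le_trans (rounding_cost R _ _ _ _ L h L_ge0 gr small) _.
rewrite big_sumType /= -(pair_bigA _ (fun x i => 1 * tdist (f (inl x)) (f (inl (x + g i))))).
rewrite /= mulr_sumr; apply: lerD; apply: ler_sum => x _.
  apply: ler_sum => i _; rewrite mul1r !fh tdist_terminals.
  case: eqP => _ /=; rewrite ?mulr0 // mulr1.
  have := ler0n R (wlen g r (h x + h (x + g i))); lra.
rewrite ler_wpM2l // fh fr tdist_terminals.
case: eqP => [->|_]; first by rewrite cube_addvv wlen0.
by rewrite ler_wpDl // mulr_ge0.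
Qed.

End TailedCayleyGraph.

(** * Choice of parameters and conclusion *)

Theorem theorem5p1 (R : realType) :
  exists C : R, 0 < C /\
    forall N : nat, exists k : nat, (N < k)%N /\
      exists (T : finType) (G : cgraph R T) (K : {set T}),
        [/\ K \subset verts G, #|K| = k
          & forall H : cgraph R T,
              convex_zero_ext G K H ->
              (exists rho : R, flow_sparsifier G K H rho) ->
              quality_at_least G K H (C * Num.sqrt (ln k%:R))].
Proof.
(* [336 = 84 * 4]: the cost [r n L / 4] against total length at most [21 r n] forces
   [rho >= L / 84], and [sqrt (ln n) <= 4 L]. *)
exists 336^-1; split=> [|N]; first by rewrite invr_gt0.
pose r := N.+1; pose m := (10 * r)%N; exists (2 ^ m)%N.
split; first by apply: leq_trans (ltnW (ltn_expl m _)) => //; rewrite /m /r leq_pmull.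
pose L : R := Num.sqrt r%:R.
have L0 : 0 <= L by rewrite sqrtr_ge0.
have [g gr] := good_code R r isT.
have L2 : L ^+ 2 = r%:R by rewrite sqr_sqrtr.
exists (cube m + cube m)%type, (tailed_graph R m _ g L L0), (terminals m).
split; first exact: finset.subsetT.
  rewrite card_imset; last by move=> ? ? [].
  by rewrite cardsT card_ffun card_bool card_ord.
move=> H Hconv _ rho rholt Hrho.
set n : R := (2 ^ m)%:R.
have n0 : 0 < n by rewrite ltr0n expn_gt0.
have r0 : 0 < r%:R :> R by rewrite ltr0n.
(* This fits dimension [10 r] exactly: [4 <= 8^r] as [r] is positive, and
   [8^r * 128^r = 2^(10 r) = n]. *)
have small : 4 * #|[set J : {set 'I_(20 * r)} | (#|J| < r)%N]|%:R <= n.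
  apply: le_trans (_ : 8 ^+ r * 128 ^+ r <= _).
    apply: ler_pM => //; last exact: card_small_subsets.
    rewrite /r exprS; have : (1 : R) <= 8 ^+ N by rewrite exprn_ege1 //; lra.
    by lra.
  have e : (8 * 128 : R) = 2 ^+ 10 by ring.
  by rewrite -exprMn e -exprM /n natrX.
have phi0 s : s \in terminals m -> tdist R m _ g r L s s = 0.
  by rewrite /tdist eqxx.
have := convex_zero_ext_congestion _ _ _ _ _ _ _ _ (tlen R m L)
  Hconv Hrho (fun e _ => tlen_ge0 _ _ _ L0 e) (tdist_edge _ _ _ _ _ _ L0) phi0
  (fun f => tailed_zero_ext_cost _ _ _ _ _ _ L0 f gr small).
have := sum_tlen R m _ g r L L0 L2.
have : 0 <= \sum_(e in edges (tailed_graph R m _ g L L0))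
    cap (tailed_graph R m _ g L L0) e * tlen R m L e.
  by apply: sumr_ge0 => e eG; rewrite mulr_ge0 ?cap_ge0 ?tlen_ge0.
set len_sum := \sum_(e in _) _; rewrite -/n natrM => len0 len_up low.
have Lpos : 0 < L by rewrite sqrtr_gt0.
have nrL : 0 < r%:R * n * L by rewrite !mulr_gt0.
have rhoL : rho < L / 84.
  apply: lt_le_trans rholt _.
  suff : Num.sqrt (ln n) <= 4 * L by lra.
  rewrite -(@ger0_norm _ (4 * L)) ?mulr_ge0 // -sqrtr_sqr ler_wsqrtr //.
  (* With [ln 2 <= 1], [ln n <= 10 r], which is below [(4 L)^2 = 16 r]. *)
  have ln2 : ln (2 : R) <= 1 by have := @le_ln1Dx R 1; rewrite -natr1; apply; lra.
  rewrite /n natrX lnXn // -[ln _ *+ _]mulr_natl exprMn L2 /m natrM.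
  by have := ler_wpM2l (ltW r0) ln2; lra.
(* Multiplying the upper bound on the total length by [rho] requires a sign; a nonpositive [rho]
   already contradicts the positive cost. *)
have [rho_le0|rho_gt0] := lerP rho 0.
  by have := mulr_le0_ge0 rho_le0 len0; lra.
have A := ler_wpM2l (ltW rho_gt0) len_up.
have B : rho * (n * r%:R) < L / 84 * (n * r%:R) by rewrite ltr_pM2r ?mulr_gt0.
lra.
Qed.
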